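(* Let $V$ be an infinite-dimensional vector space over an arbitrary field. Denote by $\mathrm{Fin}\,V$ the set of all finite-dimensional subspaces of $V$. Then there exists a binary operation $\ast$ on $\mathrm{Fin}\,V$ such that (i) $(\mathrm{Fin}\,V,\ast)$ is a free commutative monoid; (ii) for any $F,G\in \mathrm{Fin}\,V$ we have $F\subseteq F\ast G$ and $G\subseteq F\ast G$. Consequently, the Grothendieck group of $(\mathrm{Fin}\,V,\ast)$ is a free Abelian group.
   Context: $\mathbb N=\{0,1,2,\ldots\}$ is the additive monoid of non-negative integers. A free commutative monoid is a monoid isomorphic to the direct sum $\mathbb N^{(\alpha)}$ of $\alpha$-many copies of $\mathbb N$ for some cardinal $\alpha$. A free Abelian group is a group isomorphic to the direct sum $\mathbb Z^{(\alpha)}$ of $\alpha$-many copies of $\mathbb Z$ for some cardinal $\alpha$. The Grothendieck group $G(S)$ of a cancellative commutative semigroup $(S,+)$ is the group of equivalence classes of the relation on $S\times S$ given by $(s_1,t_1)\sim(s_2,t_2)\iff s_1+t_2=t_1+s_2$, the class of $(s,t)$ being regarded as $s-t$. *)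

(* Defs.v *)
From HB Require Import structures.
From mathcomp Require Import all_boot all_order all_algebra generic_quotient.
From mathcomp Require Import all_classical.

Set Implicit Arguments.
Unset Strict Implicit.
Unset Printing Implicit Defensive.

Import GRing.Theory.

Local Open Scope classical_set_scope.
Local Open Scope ring_scope.
Local Open Scope quotient_scope.

Section FiniteDimensionalSubspaces.
Variables (K : fieldType) (V : lmodType K).

Definition lspan n (b : 'I_n -> V) : set V :=
  [set \sum_(i < n) c i *: b i | c in [set: 'I_n -> K]].

Definition finite_dimensional (U : set V) : Prop :=
  exists (n : nat) (b : 'I_n -> V), U = lspan b.

Definition Fin : set (set V) :=
  [set U | GRing.submod_closed (mem U) /\ finite_dimensional U].

End FiniteDimensionalSubspaces.

Arguments Fin {K} V.

Section DirectSum.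
Variables (A : Type) (M : nmodType).

Definition finite_support : {pred A -> M} :=
  fun f => `[< finite_set [set a | f a != 0] >].

(* M^(A): the direct sum of A-many copies of M, with pointwise addition. *)
Record direct_sum := DirectSum {
  dsum_fun :> A -> M;
  dsum_funP : dsum_fun \in finite_support
}.

HB.instance Definition _ := [isSub for dsum_fun].
HB.instance Definition _ := [Choice of direct_sum by <:].

Lemma finite_support_nmod_closed : GRing.nmod_closed finite_support.
Proof.
split=> [|f g /asboolP finf /asboolP fing]; apply/asboolP.
  rewrite (_ : [set _ | _] = set0) // -subset0 => a /=.
  by rewrite eqxx.
apply: (sub_finite_set _ (_ : finite_set
  ([set a | f a != 0] `|` [set a | g a != 0]))); last by rewrite finite_setU.
move=> a /=; have [fa0|] := eqVneq (f a) 0; last by left.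
by rewrite [(f + g) a](_ : _ = f a + g a) // fa0 add0r; right.
Qed.

HB.instance Definition _ :=
  GRing.SubChoice_isSubNmodule.Build _ _ direct_sum finite_support_nmod_closed.

End DirectSum.

Section DirectSumZmod.
Variables (A : Type) (M : zmodType).

Lemma finite_support_oppr_closed : GRing.oppr_closed (@finite_support A M).
Proof.
move=> f /asboolP finf; apply/asboolP; apply: sub_finite_set finf => a /=.
by rewrite [(- f) a](_ : _ = - f a) // oppr_eq0.
Qed.

HB.instance Definition _ := GRing.SubNmodule_isSubZmodule.Build
  _ _ (direct_sum A M) finite_support_oppr_closed.

End DirectSumZmod.

Definition isomorphic (M N : nmodType) : Prop :=
  exists f : {additive M -> N}, bijective f.

Definition free_commutative_monoid (M : nmodType) : Prop :=
  exists A : Type, isomorphic M (direct_sum A nat).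

Definition free_abelian_group (G : zmodType) : Prop :=
  exists A : Type, isomorphic G (direct_sum A int).

Definition cancellative (M : nmodType) : Prop := left_injective (@GRing.add M).

Section Grothendieck.
Variables (M : nmodType) (canM : cancellative M).
Implicit Types p q : M * M.

(* The pair (s, t) stands for the formal difference s - t. *)
Definition groth_rel p q : bool := p.1 + q.2 == p.2 + q.1.

Lemma groth_rel_refl : reflexive groth_rel.
Proof. by move=> p; rewrite /groth_rel addrC eqxx. Qed.

Lemma groth_rel_sym : symmetric groth_rel.
Proof.
by move=> p q; rewrite /groth_rel eq_sym addrC [p.1 + _]addrC.
Qed.

Lemma groth_rel_trans : transitive groth_rel.
Proof.
move=> q p r /eqP pq /eqP qr; apply/eqP; apply: (canM (x := q.2)).
by rewrite addrAC pq -addrA qr addrA addrAC.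
Qed.

Canonical groth_equiv :=
  EquivRel groth_rel groth_rel_refl groth_rel_sym groth_rel_trans.

Definition grothendieck := {eq_quot groth_rel}.

HB.instance Definition _ : EqQuotient _ groth_rel grothendieck :=
  EqQuotient.on grothendieck.
HB.instance Definition _ := Choice.on grothendieck.

Definition groth_zero : grothendieck := \pi_grothendieck (0, 0).
Definition groth_add := lift_op2 grothendieck (fun p q => p + q).
Definition groth_opp := lift_op1 grothendieck (fun p => (p.2, p.1)).

Lemma groth_repr p :
  p.1 + (repr (\pi_grothendieck p)).2 = p.2 + (repr (\pi_grothendieck p)).1.
Proof.
have /eqmodP/eqP/= -> // : p = repr (\pi_grothendieck p) %[mod grothendieck].
by rewrite reprK.
Qed.

Lemma pi_groth_add : {morph \pi : p q / p + q >-> groth_add p q}.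
Proof.
move=> p q; unlock groth_add; apply/eqmodP; rewrite /= /groth_rel /=.
by rewrite addrACA !groth_repr addrACA.
Qed.
Canonical pi_groth_add_morph := PiMorph2 pi_groth_add.

Lemma pi_groth_opp : {morph \pi : p / (p.2, p.1) >-> groth_opp p}.
Proof.
move=> p; unlock groth_opp; apply/eqmodP; rewrite /= /groth_rel /=.
by rewrite -groth_repr eqxx.
Qed.
Canonical pi_groth_opp_morph := PiMorph1 pi_groth_opp.

Lemma groth_addA : associative groth_add.
Proof.
elim/quotW=> p; elim/quotW=> q; elim/quotW=> r.
by rewrite -!pi_groth_add addrA.
Qed.

Lemma groth_addC : commutative groth_add.
Proof.
by elim/quotW=> p; elim/quotW=> q; rewrite -!pi_groth_add addrC.
Qed.

Lemma groth_add0 : left_id groth_zero groth_add.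
Proof.
elim/quotW=> p; rewrite -pi_groth_add; congr \pi_grothendieck.
exact: add0r.
Qed.

Lemma groth_addN : left_inverse groth_zero groth_opp groth_add.
Proof.
elim/quotW=> p; rewrite -pi_groth_opp -pi_groth_add; apply/eqmodP.
by rewrite /= /groth_rel /= !addr0 addrC eqxx.
Qed.

HB.instance Definition _ := GRing.isZmodule.Build grothendieck
  groth_addA groth_addC groth_add0 groth_addN.

End Grothendieck.

Section MonoidOf.
Variables (T : choiceType) (op : T -> T -> T) (e : T).

(* T with op as addition and e as zero; the laws are arguments so that the
   nmodType structure below can be inferred. *)
Definition monoid_of
  of associative op & commutative op & left_id e op : Type := T.

Variables (opA : associative op) (opC : commutative op) (op0 : left_id e op).

HB.instance Definition _ := Choice.on (monoid_of opA opC op0).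
HB.instance Definition _ :=
  GRing.isNmodule.Build (monoid_of opA opC op0) opA opC op0.

End MonoidOf.

(* Main.v *)
(* A monoid structure as required is the same thing as a bijection
   f : N^(A) -> Fin V that is monotone, i.e. f m `<=` f (m + n).

   Suppose that to every finite multiset l of nonzero finite-dimensional subspaces
   a subspace [code l] is attached, injectively and monotonically, which contains
   all members of l and has larger rank (a natural number) than each of them.  Call a
   nonzero F a generator if it is not [code l] for a multiset l of at least two
   generators; this recursion on the rank is well founded.  Then 0 |-> 0,
   [F] |-> F and l |-> [code l] for larger l is a monotone bijection from the
   multisets of generators onto Fin V.

   To get [code], let I index a basis of V.  Since I * nat embeds into I, there are
   linear maps sh n, pr n : V -> V with pr m \o sh n = 0 for m != n, = id for m = n,
   and pr n v = 0 for large n.  A list of nonzero subspaces F_0, ..., F_(k-1) is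
   recovered from its packing P = sum of the sh i (F_i).  Give l a height h(l) that
   is strictly monotone and such that pr n kills the members of l for n >= h(l);
   then code l is the sum of the members of l and of sh (h(s)) (P(s)) for all
   submultisets s of l.  The largest n with pr n (code l) <> 0 is h(l), and
   pr (h(l)) (code l) = P(l) determines l. *)
From HB Require Import structures.
Require Import Defs.
From mathcomp Require Import all_boot all_order all_algebra generic_quotient.
From mathcomp Require Import all_classical.

Set Implicit Arguments.
Unset Strict Implicit.
Unset Printing Implicit Defensive.

Import GRing.Theory.

Local Open Scope classical_set_scope.
Local Open Scope ring_scope.

(** * Absorption of a factor [nat] by an infinite set *)

Lemma infinite_absorbs_nat (T : choiceType) (B : set T) : infinite_set B ->
  exists g : T -> nat -> T, (forall x n, B x -> B (g x n)) /\
    (forall x y m n, B x -> B y -> g x m = g y n -> x = y /\ m = n).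
Proof.
move=> infB.
pose D : set (nat -> T) := [set s | injective s /\ range s `<=` B].
(* [E] is a maximal family of injective sequences in [B] with pairwise disjoint ranges. An infinite
   remainder [R] would contain one more such sequence, so [R] is finite. *)
have [E [ED trivE maxE]] :=
  ex_maximal_disjoint_subcollection (fun s => range s) D.
pose R := B `\` \bigcup_(s in E) range s.
have finR : finite_set R.
  apply: contrapT => /infiniteP/card_leP[f].
  pose s k : T := val (f (to_setT k)).
  have sR k : R (s k) by exact: set_mem (valP (f (to_setT k))).
  have sinj : injective s.
    move=> i j /val_inj/(@inj _ _ _ f); rewrite !inE => /(_ I I) h.
    by have := congr1 val h.
  have sE : ~ E s.
    by move=> Es; have [_] := sR 0%N; apply; exists s => //; exists 0%N.
  apply: (maxE (s |` E)).
  - split; first by move=> t; right.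
    by move=> /(_ s) h; apply: sE; apply: h; left.
  - move=> t [->|/ED//]; split=> // _ [k _ <-]; exact: (sR k).1.
  - have aux t : E t -> range s `&` range t !=set0 -> False.
      move=> Et [_ [[k _ <-] tk]]; have [_] := sR k; apply; exists t => //.
    move=> i j [->|Ei] [->|Ej] //; last exact: trivE.
      by move=> /aux -/(_ Ej).
    by rewrite setIC => /aux -/(_ Ei).
have [s0 Es0] : exists s0, E s0.
  apply: contrapT => nE; apply: infB; apply: sub_finite_set finR => x Bx.
  by split=> // -[s Es]; have := nE; case; exists s.
have /countable_injP[r rinj] := finite_set_countable finR.
(* Even positions of the sequences in E host the elements they list, odd positions
   of s0 host the finitely many elements R left over. *)
have /choice[c cP] : forall x, exists p : (nat -> T) * nat, B x ->
    E p.1 /\ ((R x /\ p = (s0, (r x).*2.+1)) \/ exists2 k, p.1 k = x & p.2 = k.*2).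
  move=> x; have [[s Es [k _ skx]]|nx] := pselect ((\bigcup_(s in E) range s) x).
    by exists (s, k.*2) => _; split=> //; right; exists k.
  by exists (s0, (r x).*2.+1) => Bx; split => //; left.
have cinj x y : B x -> B y -> c x = c y -> x = y.
  move=> Bx By cxy.
  have [_ [[Rx cx]|[k xk kx]]] := cP x Bx;
    have [_ [[Ry cy]|[l yl ly]]] := cP y By.
  - move: cxy; rewrite cx cy => -[/double_inj/rinj->] //; exact: mem_set.
  - by move/(congr1 (odd \o snd)): cxy; rewrite cx /= ly /= !odd_double.
  - by move/(congr1 (odd \o snd)): cxy; rewrite cy /= kx /= !odd_double.
  - by rewrite -xk -yl -cxy; congr (_ _); apply: double_inj; rewrite -kx -ly cxy.
(* Disjointness of the ranges recovers the sequence hosting [x]; injectivity of this sequence and of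
   [pickle] on pairs recovers the position of [x] and [n]. *)
exists (fun x n => (c x).1 (pickle ((c x).2, n))); split.
  move=> x n /cP[/ED[_ sB] _]; apply: sB; exact: imageT.
move=> x y m n Bx By; have [Ex _] := cP x Bx; have [Ey _] := cP y By => e.
have e1 : (c x).1 = (c y).1.
  apply: trivE => //; exists ((c x).1 (pickle ((c x).2, m))).
  by split; [|rewrite e]; exact: imageT.
move: e; rewrite -e1 => /(ED _ Ex).1/(pcan_inj pickleK)[e2 ->]; split=> //.
by apply: cinj => //; rewrite [LHS]surjective_pairing e1 e2 -surjective_pairing.
Qed.

(** * Bases, coordinates and linear maps prescribed on a basis *)

Section Bases.
Variables (K : fieldType) (V : lmodType K).
Implicit Types (B : set V) (c d : V -> K) (f : V -> V) (s : seq V).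

Definition vanishes_off s c := forall x, x \notin s -> c x = 0.

Definition coefficients B c :=
  (exists s, vanishes_off s c) /\ forall x, c x != 0 -> B x.

Definition lincomb f c : V := \sum_(x \in [set: V]) c x *: f x.

Definition linindep B :=
  forall c, coefficients B c -> lincomb id c = 0 -> forall x, c x = 0.

Definition is_basis B :=
  linindep B /\ forall v, exists2 c, coefficients B c & lincomb id c = v.

Lemma lincombE f c s : uniq s -> vanishes_off s c ->
  lincomb f c = \sum_(x <- s) c x *: f x.
Proof.
move=> us sc; rewrite [RHS](bigfs _ us (P := predT)) ?set_true // => i _ /sc ->.
by rewrite scale0r.
Qed.

Lemma common_support B B' c d : coefficients B c -> coefficients B' d ->
  exists s, [/\ uniq s, vanishes_off s c & vanishes_off s d].
Proof.
move=> [[s sc] _] [[t td] _]; exists (undup (s ++ t)); split.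
- exact: undup_uniq.
- by move=> x; rewrite mem_undup mem_cat negb_or => /andP[/sc].
- by move=> x; rewrite mem_undup mem_cat negb_or => /andP[_ /td].
Qed.

Lemma lincomb_linear f B a c d : coefficients B c -> coefficients B d ->
  lincomb f (fun x => a * c x + d x) = a *: lincomb f c + lincomb f d.
Proof.
move=> Bc Bd; have [s [us sc sd]] := common_support Bc Bd.
rewrite !(lincombE _ us) //; last by move=> x xs; rewrite sc ?sd // mulr0 addr0.
rewrite scaler_sumr -big_split; apply: eq_bigr => x _.
by rewrite /= scalerDl scalerA.
Qed.

Lemma coefficients_linear B a c d : coefficients B c -> coefficients B d ->
  coefficients B (fun x => a * c x + d x).
Proof.
move=> Bc Bd; have [s [us sc sd]] := common_support Bc Bd; split.
  by exists s => x xs; rewrite sc ?sd // mulr0 addr0.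
move=> x; have [->|/Bd.2 //] := eqVneq (d x) 0.
by rewrite addr0 mulf_eq0 negb_or => /andP[_ /Bc.2].
Qed.

Definition delta (v x : V) : K := (x == v)%:R.

Lemma delta_coefficients B v : B v -> coefficients B (delta v).
Proof.
move=> Bv; split; first by exists [:: v] => x; rewrite inE /delta => /negbTE->.
by move=> x; rewrite /delta; case: (eqVneq x v) => [->|_] //; rewrite eqxx.
Qed.

Lemma lincomb_delta f v : lincomb f (delta v) = f v.
Proof.
rewrite (@lincombE _ _ [:: v]) // ?big_seq1 /delta ?eqxx ?scale1r //.
by move=> x; rewrite inE /delta => /negbTE->.
Qed.

(** The chain condition for Zorn's lemma: a linear relation has finite support, so it already lives
    in one member of the chain. *)
Lemma linindep_bigcup (F : set (set V)) : F `<=` linindep ->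
  total_on F subset -> linindep (\bigcup_(X in F) X).
Proof.
move=> Flin Ftot c [[s sc] cF] c0 z; apply/eqP; apply: contraT => cz0.
have [X0 FX0 _] := cF _ cz0.
have [X [FX sX]] : exists X, F X /\ forall x, x \in s -> c x != 0 -> X x.
  elim: s {sc} => [|x s [Y [FY sY]]]; first by exists X0.
  have [cx0|cx0] := eqVneq (c x) 0.
    exists Y; split=> // y; rewrite inE => /predU1P[->|]; last exact: sY.
    by rewrite cx0 eqxx.
  have [Z FZ Zx] := cF _ cx0; have [YZ|ZY] := Ftot _ _ FY FZ.
    exists Z; split=> // y; rewrite inE => /predU1P[-> //|ys cy].
    by apply: YZ; exact: sY.
  exists Y; split=> // y; rewrite inE => /predU1P[-> _|ys cy]; last exact: sY.
  exact: ZY.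
rewrite (Flin X FX c) ?eqxx // in cz0; split; first by exists s.
by move=> x cx0; apply: sX => //; apply: contraNT cx0 => /sc ->.
Qed.

Lemma exists_basis : exists B, is_basis B.
Proof.
have [B [indB maxB]] := Zorn_bigcup linindep_bigcup.
exists B; split=> // v; apply: contrapT => nspan.
have nBv : ~ B v.
  move=> Bv; apply: nspan; exists (delta v); first exact: delta_coefficients.
  exact: lincomb_delta.
apply: (maxB (v |` B)).
  split; first by move=> x; right.
  by move=> /(_ v) h; apply: nBv; apply: h; left.
(* [c'] is [c] with its coefficient at [v] removed. It is supported in [B] and represents
   [- c v *: v], so [c v != 0] would put [v] in the span of [B]. *)
move=> c cB c0; pose c' x := - c v * delta v x + c x.
have coef' : coefficients (v |` B) c'.
  by apply: coefficients_linear => //; apply: delta_coefficients; left.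
have c'v : c' v = 0 by rewrite /c' /delta eqxx mulr1 addNr.
have Bc' : coefficients B c'.
  split; first exact: coef'.1.
  by move=> x c'x; have [xv|//] := coef'.2 _ c'x; rewrite xv c'v eqxx in c'x.
have lc' : lincomb id c' = - c v *: v.
  rewrite (@lincomb_linear _ (v |` B)) // ?c0 ?lincomb_delta ?addr0 //.
  by apply: delta_coefficients; left.
have cv0 : c v = 0.
  apply/eqP; apply: contra_notT nspan => cv0.
  have B0 : coefficients B (fun=> 0).
    by split; [exists [::] | move=> x; rewrite eqxx].
  exists (fun x => - (c v)^-1 * c' x + 0); first exact: coefficients_linear.
  rewrite (@lincomb_linear _ B) // lc' scalerA mulrNN mulVf // scale1r.
  by rewrite (@lincombE _ _ [::]) // big_nil addr0.
have cc' : c' = c by apply/funext => x; rewrite /c' cv0 oppr0 mul0r add0r.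
by move: Bc'; rewrite cc' => /indB; apply.
Qed.

Section Coordinates.
Variables (B : set V) (basisB : is_basis B).

Definition coord v : V -> K :=
  xget (fun=> 0) [set c | coefficients B c /\ lincomb id c = v].

Lemma coord_spec v : coefficients B (coord v) /\ lincomb id (coord v) = v.
Proof.
rewrite /coord; case: xgetP => [c _ //|no]; have [c Bc cv] := basisB.2 v.
by have := no c; case.
Qed.

Lemma coord_unique v c : coefficients B c -> lincomb id c = v -> c = coord v.
Proof.
move=> Bc cv; have [Bv vE] := coord_spec v; apply/funext => x.
apply/esym/eqP; rewrite -subr_eq0 addrC -mulN1r; apply/eqP; move: x.
apply: basisB.1; first exact: coefficients_linear.
by rewrite (@lincomb_linear _ B) // cv vE scaleN1r addNr.
Qed.

Definition extend f v := lincomb f (coord v).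

Fact extend_linear f : linear (extend f).
Proof.
move=> a u v; rewrite /extend.
have [Bu uE] := coord_spec u; have [Bv vE] := coord_spec v.
rewrite -(@coord_unique _ (fun x => a * coord u x + coord v x)).
- exact: lincomb_linear Bu Bv.
- exact: coefficients_linear.
- by rewrite (@lincomb_linear _ B) // uE vE.
Qed.

Definition linear_extension f : {linear V -> V} := HB.pack (extend f)
  (GRing.isLinear.Build K V V *:%R (extend f) (extend_linear f)).

Lemma linear_extensionE f v : B v -> linear_extension f v = f v.
Proof.
move=> Bv; rewrite /= /extend -(@coord_unique v (delta v)) ?lincomb_delta //.
exact: delta_coefficients.
Qed.

Lemma basis_ind (P : V -> Prop) : P 0 ->
  (forall a u v, B u -> P v -> P (a *: u + v)) -> forall v, P v.
Proof.
move=> P0 PD v; have [[[s0 s0c] cB] <-] := coord_spec v.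
rewrite (@lincombE _ _ (undup s0)) ?undup_uniq //; last first.
  by move=> x; rewrite mem_undup => /s0c.
elim: (undup s0) => [|x s IH]; first by rewrite big_nil.
rewrite big_cons; have [->|/cB Bx] := eqVneq (coord v x) 0; last exact: PD.
by rewrite scale0r add0r.
Qed.

End Coordinates.

Lemma finite_dimensional_basis B : is_basis B -> finite_set B ->
  finite_dimensional [set: V].
Proof.
move=> basisB /finite_seqP[s Bs].
exists (size s), (tnth (in_tuple s)); apply/seteqP; split=> // v _.
elim/(basis_ind basisB): v => [|a u v Bu [c _ <-]].
  by exists (fun=> 0) => //; rewrite big1 // => i _; rewrite scale0r.
have us : u \in s by move: Bu; rewrite Bs.
have iP : (index u s < size s)%N by rewrite index_mem.
exists (fun i => a * (i == Ordinal iP)%:R + c i) => //.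
under eq_bigr do rewrite scalerDl -scalerA.
rewrite big_split /= -scaler_sumr (bigD1 (Ordinal iP)) //= eqxx scale1r.
rewrite (tnth_nth 0) /= nth_index // big1 ?addr0 // => i /negbTE->.
by rewrite scale0r.
Qed.

Lemma exists_shifts : ~ finite_dimensional [set: V] ->
  exists sh pr : nat -> {linear V -> V},
    (forall m n v, pr m (sh n v) = if m == n then v else 0) /\
    (forall v, exists N, forall n, (N <= n)%N -> pr n v = 0).
Proof.
move=> infV; have [B basisB] := exists_basis.
have [g [gB ginj]] : exists g : V -> nat -> V, (forall x n, B x -> B (g x n)) /\
    (forall x y m n, B x -> B y -> g x m = g y n -> x = y /\ m = n).
  by apply: infinite_absorbs_nat => /(finite_dimensional_basis basisB).
(* Extended linearly, [g^~ n] moves the basis onto its n-th copy inside itself and [h n] moves that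
   copy back. The default 0 makes [h n] kill all other basis vectors. *)
pose h n x := xget 0 [set y | B y /\ g y n = x].
have hg m n x : B x -> h m (g x n) = if m == n then x else 0.
  move=> Bx; rewrite /h; case: xgetP => [y _ [By /(ginj _ _ _ _ By Bx)[-> ->]]|no].
    by rewrite eqxx.
  by case: eqVneq => // mn; have := no x; case; rewrite mn.
exists (fun n => linear_extension basisB (g^~ n)).
exists (fun n => linear_extension basisB (h n)).
split.
  move=> m n v; elim/(basis_ind basisB): v => [|a u v Bu IH].
    by rewrite !linear0 if_same.
  rewrite !linearP IH !linear_extensionE ?hg //; last exact: gB.
  by case: eqP => // _; rewrite scaler0 addr0.
move=> v; elim/(basis_ind basisB): v => [|a u v Bu [N vN]].
  by exists 0%N => n _; rewrite linear0.
(* The basis vector [u] lies in at most one copy, so every later [h n] kills it. *)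
have [N' uN'] : exists N', forall n, (N' <= n)%N -> h n u = 0.
  have [[m [y By yu]]|no] := pselect (exists m, exists2 y, B y & g y m = u).
    by exists m.+1 => n mn; rewrite -yu hg // gtn_eqF.
  exists 0%N => n _; rewrite /h; case: xgetP => // y _ [By yu].
  by case: no; exists n, y.
exists (maxn N N') => n; rewrite geq_max => /andP[/vN nv /uN' nu].
by rewrite linearP nv addr0 linear_extensionE // nu scaler0.
Qed.

End Bases.

(** * Finite-dimensional subspaces, their sums and images *)

Section Subspaces.
Variables (K : fieldType) (V : lmodType K).
Implicit Types (U W : set V) (F G : Fin V) (Fs : seq (Fin V)).

Definition subspace U := U 0 /\ forall a u v, U u -> U v -> U (a *: u + v).

Lemma subspaceP U : subspace U <-> GRing.submod_closed (mem U).
Proof.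
split=> -[U0 UD]; split.
- exact: mem_set.
- by move=> a u v /set_mem Uu /set_mem Uv; apply/mem_set/UD.
- exact: set_mem.
- by move=> a u v /mem_set Uu /mem_set Uv; apply/set_mem/UD.
Qed.

Lemma Fin_subspace F : subspace (val F).
Proof. by have [/(subspaceP _).2] := set_mem (valP F). Qed.

Lemma subspaceD U u v : subspace U -> U u -> U v -> U (u + v).
Proof. by move=> [_ UD] Uu /(UD 1 _ _ Uu); rewrite scale1r. Qed.

Lemma lspan_subspace n (b : 'I_n -> V) : subspace (lspan b).
Proof.
split; first by exists (fun=> 0) => //; rewrite big1 // => i _; rewrite scale0r.
move=> a _ _ [c _ <-] [d _ <-]; exists (fun i => a * c i + d i) => //.
rewrite scaler_sumr -big_split; apply: eq_bigr => i _.
by rewrite scalerDl scalerA.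
Qed.

Lemma lspan_Fin n (b : 'I_n -> V) : lspan b \in Fin V.
Proof.
by apply/mem_set; split; [exact/(subspaceP _).1/lspan_subspace | exists n, b].
Qed.

Definition spanF n (b : 'I_n -> V) : Fin V := SigSub (lspan_Fin b).

Lemma Fin_spanP F : exists n (b : 'I_n -> V), F = spanF b.
Proof.
case: F => U UF; have [_ [n [b Ub]]] := set_mem UF.
by exists n, b; apply: val_inj.
Qed.

Lemma sub_lspan n (b : 'I_n -> V) W : subspace W ->
  lspan b `<=` W <-> forall i, W (b i).
Proof.
move=> WW; split=> [bW i|bW _ [c _ <-]].
  apply: bW; exists (fun j => (j == i)%:R) => //.
  rewrite (bigD1 i) //= eqxx scale1r big1 ?addr0 // => j /negbTE->.
  by rewrite scale0r.
elim/big_ind: _ => [|u v|i _]; first exact: WW.1.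
  exact: subspaceD.
by rewrite -[_ *: _]addr0; apply: WW.2 => //; exact: WW.1.
Qed.

Lemma exists_add F G : exists H : Fin V, forall W, subspace W ->
  val H `<=` W <-> val F `<=` W /\ val G `<=` W.
Proof.
have [m [b ->]] := Fin_spanP F; have [n [c ->]] := Fin_spanP G.
exists (spanF (fun i : 'I_(m + n) =>
  match fintype.split i with inl j => b j | inr j => c j end)) => W WW.
rewrite !sub_lspan //; split=> [h|[hb hc] i]; last by case: fintype.split.
split=> i; first by have := h (unsplit (inl i)); rewrite unsplitK.
by have := h (unsplit (inr i)); rewrite unsplitK.
Qed.

Definition zeroF : Fin V := spanF (fun i : 'I_0 => 0).

Lemma zeroFE : val zeroF = [set 0].
Proof.
apply/seteqP; split=> [_ [c _ <-]|_ ->]; first by rewrite big_ord0.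
exact: (Fin_subspace zeroF).1.
Qed.

(** The sum is specified by its universal property, so that it is shown to lie in a subspace summand
    by summand. *)
Lemma exists_sum Fs : exists H : Fin V, forall W, subspace W ->
  val H `<=` W <-> forall F, F \in Fs -> val F `<=` W.
Proof.
elim: Fs => [|F Fs [G GP]].
  exists zeroF => W [W0 _]; split=> // _.
  by rewrite zeroFE => _ ->.
have [H HP] := exists_add F G; exists H => W WW.
rewrite HP // GP //; split=> [[FW FsW] E|h].
  by rewrite inE => /predU1P[->|/FsW].
by split=> [|E Es]; apply: h; rewrite inE ?eqxx ?Es ?orbT.
Qed.

Definition sumF Fs : Fin V := sval (cid (exists_sum Fs)).

Lemma sumFP Fs W : subspace W ->
  val (sumF Fs) `<=` W <-> forall F, F \in Fs -> val F `<=` W.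
Proof. exact: (svalP (cid (exists_sum Fs))). Qed.

Lemma sumF_sup Fs F : F \in Fs -> val F `<=` val (sumF Fs).
Proof. by move: F; apply/sumFP; first exact: Fin_subspace. Qed.

Lemma exists_image (f : {linear V -> V}) F :
  exists G : Fin V, val G = f @` val F.
Proof.
have [n [b ->]] := Fin_spanP F; exists (spanF (f \o b)).
apply/seteqP; split=> [_ [c _ <-]|_ [_ [c _ <-] <-]].
  exists (\sum_i c i *: b i); first by exists c.
  by rewrite linear_sum; apply: eq_bigr => i _; rewrite linearZ.
exists c => //; rewrite linear_sum; apply: eq_bigr => i _; rewrite linearZ //.
Qed.

Definition imF (f : {linear V -> V}) F : Fin V := sval (cid (exists_image f F)).

Lemma imFE f F : val (imF f F) = f @` val F.
Proof. exact: (svalP (cid (exists_image f F))). Qed.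

Lemma preim_subspace (f : {linear V -> V}) W : subspace W ->
  subspace (f @^-1` W).
Proof.
move=> [W0 WD]; split; first by rewrite /= linear0.
by move=> a u v Wu Wv; rewrite /= linearP; exact: WD.
Qed.

Lemma sub_imF f F W : val (imF f F) `<=` W <-> val F `<=` f @^-1` W.
Proof.
rewrite imFE; split=> [h u Fu|h _ [u Fu <-]]; last exact: h.
by apply: h; exists u.
Qed.

Lemma sub0F F : val zeroF `<=` val F.
Proof. by rewrite zeroFE => _ ->; exact: (Fin_subspace F).1. Qed.

End Subspaces.
Arguments zeroF {K V}.

(** * Coding multisets of subspaces by subspaces *)

Section Code.
Variables (K : fieldType) (V : lmodType K).
Variables sh pr : nat -> {linear V -> V}.
Hypothesis prsh : forall m n v, pr m (sh n v) = if m == n then v else 0.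
Hypothesis pr_eventually0 :
  forall v, exists N, forall n, (N <= n)%N -> pr n v = 0.
Implicit Types (F : Fin V) (l s : seq (Fin V)).

(** The maximum of the bounds for the members of a finite spanning family works. *)
Lemma exists_level F : exists N, forall n, (N <= n)%N ->
  val F `<=` pr n @^-1` [set 0].
Proof.
have [m [b ->]] := Fin_spanP F.
have /choice[N NP] : forall i, exists N, forall n, (N <= n)%N -> pr n (b i) = 0.
  by move=> i; exact: pr_eventually0.
exists (\max_(i < m) N i)%N => n mn; apply/sub_lspan.
  by rewrite -zeroFE; apply: preim_subspace; exact: Fin_subspace.
move=> i; apply: NP; apply: leq_trans mn; exact: leq_bigmax.
Qed.

(** Any such bound will do, not only the least one. It is the rank on which the recursion for
    generators runs. *)
Definition level F : nat := sval (cid (exists_level F)).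

Lemma levelP F n : (level F <= n)%N -> val F `<=` pr n @^-1` [set 0].
Proof. exact: (svalP (cid (exists_level F))). Qed.

Definition pack l : Fin V :=
  sumF (mkseq (fun i => imF (sh i) (nth zeroF l i)) (size l)).

(** [pr i] kills every shifted entry except the i-th. Past the end of [l] it kills all of them, in
    agreement with the default [zeroF]. *)
Lemma pr_pack l i : pr i @` val (pack l) = val (nth zeroF l i).
Proof.
apply/seteqP; split=> [_ [v vl <-]|v].
  have WW := preim_subspace (pr i) (Fin_subspace (nth zeroF l i)).
  move: v vl; apply/(sumFP _ WW) => G /mapP[j _ ->].
  apply/sub_imF => v jv; rewrite /= prsh.
  by case: eqP => [->//|_]; exact: (Fin_subspace _).1.
have [il|li] := ltnP i (size l); last first.
  rewrite nth_default // zeroFE => ->; exists 0; last by rewrite linear0.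
  exact: (Fin_subspace _).1.
move=> vl; exists (sh i v); last by rewrite prsh eqxx.
apply: (@sumF_sup _ _ _ (imF (sh i) (nth zeroF l i))).
  by apply/mapP; exists i; rewrite ?mem_iota.
by rewrite imFE; exists v.
Qed.

(** The entries are read off with [pr i]. Trailing zero subspaces would leave no trace in the
    packing; without them the length is determined too. *)
Lemma pack_inj l s : zeroF \notin l -> zeroF \notin s ->
  pack l = pack s -> l = s.
Proof.
move=> l0 s0 ls.
have nE i : nth zeroF l i = nth zeroF s i.
  by apply: val_inj; rewrite /= -!pr_pack ls.
have sz l' s' : (forall i, nth zeroF l' i = nth zeroF s' i) -> zeroF \notin s' ->
    (size s' <= size l')%N.
  move=> e s'0; rewrite leqNgt; apply: contra s'0 => lt.
  by rewrite -[zeroF](nth_default zeroF (leqnn (size l'))) e mem_nth.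
by apply: (@eq_from_nth _ zeroF) => //; apply/eqP; rewrite eqn_leq !sz.
Qed.

(** Packing depends on the order of the list; a chosen representative of the permutation class makes
    [marker] a function of the multiset. *)
Definition canon l := choose (perm_eq l) l.

Lemma perm_canon l : perm_eq l (canon l).
Proof. exact: chooseP. Qed.

Lemma eq_canon l s : perm_eq l s -> canon l = canon s.
Proof.
move=> ls; have e : perm_eq l =1 perm_eq s by exact/permPl.
by rewrite /canon (eq_choose e) (choose_id (x0 := l) (y0 := s)) // -e.
Qed.

(** The levels ensure that [pr (height l)] kills the members of [l]; the term [size l] makes the
    height strictly monotone even where levels vanish. *)
Definition height l := (size l + \sum_(F <- l) level F)%N.

Lemma height_perm l s : perm_eq l s -> height l = height s.
Proof. by move=> ls; rewrite /height (perm_size ls) (perm_big _ ls). Qed.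

Lemma height_subseq s l : subseq s l -> s = l \/ (height s < height l)%N.
Proof.
move=> sl; have [t lst] := perm_to_subseq sl; rewrite (height_perm lst).
have [t0|t0] := eqVneq (size t) 0; [left|right].
  apply/eqP; rewrite -(size_subseq_leqif sl).2.
  by rewrite (perm_size lst) size_cat t0 addn0.
rewrite /height size_cat big_cat /= addnACA.
by rewrite -[ltnLHS]addn0 ltn_add2l addn_gt0 lt0n t0.
Qed.

Lemma level_height F l : F \in l -> (level F <= height l)%N.
Proof.
move=> Fl; rewrite /height (perm_big _ (perm_to_rem Fl)) big_cons /=.
by rewrite addnCA leq_addr.
Qed.

Definition marker l : Fin V := imF (sh (height l)) (pack (canon l)).

(** The masks run through all submultisets of [l]; including the markers of the proper ones makes
    the code monotone. *)
Definition code l : Fin V :=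
  sumF (l ++ [seq marker (mask (val b) l) | b <- enum {: (size l).-tuple bool}]).

Lemma sub_code l W : subspace W ->
  val (code l) `<=` W <->
  (forall F, F \in l -> val F `<=` W) /\
  (forall s, subseq s l -> val (marker s) `<=` W).
Proof.
move=> WW; rewrite sumFP //; split=> [h|[hl hs] F].
  split=> [F Fl|s /subseqP[m sm ->]]; apply: h; rewrite mem_cat ?Fl //.
  apply/orP; right; apply/mapP; have msz : size m == size l by rewrite sm.
  by exists (Tuple msz); rewrite ?mem_enum.
by rewrite mem_cat => /orP[/hl//|/mapP[b _ ->]]; apply: hs; exact: mask_subseq.
Qed.

Lemma mem_code l F : F \in l -> val F `<=` val (code l).
Proof.
by move: F; have [] := (sub_code l (Fin_subspace _)).1 (@subset_refl _ _).
Qed.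

Lemma marker_code s l : subseq s l -> val (marker s) `<=` val (code l).
Proof.
by move: s; have [] := (sub_code l (Fin_subspace _)).1 (@subset_refl _ _).
Qed.

Lemma pr_marker n s : val (marker s) `<=`
  pr n @^-1` (if n == height s then val (pack (canon s)) else [set 0]).
Proof. by apply/sub_imF => v sv; rewrite /= prsh; case: eqP. Qed.

(** Members of [l] have level at most [height l], and markers of proper subsequences sit at smaller
    heights. Hence only the marker of [l] itself survives [pr (height l)]. *)
Lemma pr_code l : pr (height l) @` val (code l) = val (pack (canon l)).
Proof.
apply/seteqP; split=> [_ [v vl <-]|v vl].
  have WW := preim_subspace (pr (height l)) (Fin_subspace (pack (canon l))).
  move: v vl; apply/(sub_code _ WW); split=> [F Fl|s /height_subseq[->|lt]].
  - apply: subset_trans (levelP (level_height Fl)) _ => v /= ->.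
    exact: (Fin_subspace _).1.
  - by have := @pr_marker (height l) l; rewrite eqxx.
  - have := @pr_marker (height l) s; rewrite gtn_eqF // => h v /h /= ->.
    exact: (Fin_subspace _).1.
exists (sh (height l) v); last by rewrite prsh eqxx.
by apply: (marker_code (subseq_refl l)); rewrite imFE; exists v.
Qed.

Lemma pr_code_above l n : (height l < n)%N ->
  val (code l) `<=` pr n @^-1` [set 0].
Proof.
move=> ln; apply/sub_code.
  by rewrite -zeroFE; apply: preim_subspace; exact: Fin_subspace.
split=> [F /level_height Fl|s sl]; first exact: (levelP (leq_trans Fl (ltnW ln))).
have sn : (height s < n)%N.
  by apply: leq_ltn_trans ln; have [->//|/ltnW] := height_subseq sl.
by have := @pr_marker n s; rewrite gtn_eqF.
Qed.

(** The empty list has zero packing as well, so [pack_inj] applies. *)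
Lemma pack_canon_eq0 l : zeroF \notin l -> val (pack (canon l)) `<=` [set 0] ->
  l = [::].
Proof.
move=> l0 p0; apply/perm_nilP.
suff -> : [::] = canon l by exact: perm_canon.
apply: pack_inj => //; first by rewrite -(perm_mem (perm_canon l)).
apply: val_inj; apply/seteqP; split=> [|v /p0 ->]; last exact: (Fin_subspace _).1.
by apply/sumFP; first exact: Fin_subspace.
Qed.

(** By [pr_code], [pr (height l)] maps [code l] onto the packing of a nonempty list, which is not
    zero. So the level of [code l] exceeds [height l], which bounds the level of [F]. *)
Lemma level_code l F : zeroF \notin l -> F \in l -> (level F < level (code l))%N.
Proof.
move=> l0 Fl; apply: (leq_ltn_trans (level_height Fl)); rewrite ltnNge.
apply/negP => /levelP le; suff l_nil : l = [::] by rewrite l_nil in Fl.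
by apply: pack_canon_eq0 => //; rewrite -pr_code => _ [v /le + <-].
Qed.

Lemma code_inj l s : zeroF \notin l -> zeroF \notin s ->
  code l = code s -> perm_eq l s.
Proof.
(* Were [height l'] larger, [pr (height l')] would kill [code s'], hence [code l'], and the packing
   of [l'] would be zero. *)
have le l' s' : zeroF \notin l' -> code l' = code s' -> (height l' <= height s')%N.
  move=> l0 ls; rewrite leqNgt; apply/negP => lt.
  suff l_nil : l' = [::] by move: lt; rewrite l_nil /height big_nil.
  apply: pack_canon_eq0 => //; rewrite -pr_code => _ [v + <-].
  by rewrite ls; exact: pr_code_above.
move=> l0 s0 ls; have hls : height l = height s by apply/eqP; rewrite eqn_leq !le.
apply: (perm_trans (perm_canon l)); rewrite perm_sym.
rewrite (@pack_inj (canon l) (canon s)) ?perm_canon //.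
- by rewrite -(perm_mem (perm_canon l)).
- by rewrite -(perm_mem (perm_canon s)).
- by apply: val_inj; rewrite /= -!pr_code ls hls.
Qed.

Lemma code_mono l s t : perm_eq s (l ++ t) -> val (code l) `<=` val (code s).
Proof.
move=> slt; apply/sub_code; first exact: Fin_subspace.
split=> [F Fl|l' l'l]; first by apply: mem_code; rewrite (perm_mem slt) mem_cat Fl.
(* A subsequence of [l] need not be one of [s], but a permutation of it is, and permuted lists have
   the same marker. *)
have [s' s's l's'] : exists2 s', subseq s' s & perm_eq l' s'.
  apply/count_subseqP => F; rewrite (permP slt) count_cat.
  exact: leq_trans (leq_count_subseq _ l'l) (leq_addr _ _).
rewrite /marker (height_perm l's') (eq_canon l's'); exact: marker_code.
Qed.

End Code.

(** * Finite multisets as elements of a direct sum of copies of [nat] *)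

Section Multisets.
Variable A : choiceType.
Implicit Types (l : seq A) (m : direct_sum A nat).

Fact count_finite_support l :
  (fun a => count_mem a l) \in @Defs.finite_support A nat.
Proof.
apply/asboolP/finite_seqP; exists (undup l); apply/seteqP; split=> a /=.
  by rewrite mem_undup -has_pred1 has_count lt0n.
by rewrite mem_undup -has_pred1 has_count lt0n.
Qed.

Definition multiset_of l : direct_sum A nat :=
  DirectSum (count_finite_support l).

Lemma exists_listing m : exists l, multiset_of l = m.
Proof.
have /asboolP/finite_seqP[s sE] := dsum_funP m.
exists (flatten [seq nseq (m a) a | a <- undup s]); apply/val_inj/funext => a /=.
have sm : forall b, b \notin s -> m b = 0%N.
  move=> b bs; apply/eqP; apply: contraNT bs => mb.
  by have : [set b | m b != 0] b by []; rewrite sE.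
rewrite count_flatten sumnE !big_map.
under eq_bigr do rewrite count_nseq /=.
have [as_|as_] := boolP (a \in s).
  rewrite (bigD1_seq a) ?mem_undup ?undup_uniq //= eqxx mul1n big1 ?addn0 //.
  by move=> b /negbTE->.
rewrite sm // big1_seq // => b /andP[_]; rewrite mem_undup => bs.
by case: eqP => // ba; rewrite -ba bs in as_.
Qed.

Definition listing m : seq A := sval (cid (exists_listing m)).

Lemma listingK : cancel listing multiset_of.
Proof. by move=> m; exact: (svalP (cid (exists_listing m))). Qed.

Lemma multiset_of_eq l s : multiset_of l = multiset_of s <-> perm_eq l s.
Proof.
split=> [ls|/permP ls]; last by apply/val_inj/funext => a; exact: ls.
apply/allP => a _ /=; apply/eqP; exact: (congr1 (fun m => m a) ls).
Qed.

Lemma perm_listing l : perm_eq (listing (multiset_of l)) l.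
Proof. by apply/multiset_of_eq; rewrite listingK. Qed.

Lemma perm_listingD m n : perm_eq (listing (m + n)) (listing m ++ listing n).
Proof.
apply/multiset_of_eq; rewrite listingK; apply/val_inj/funext => a.
rewrite /= count_cat -[count_mem a (listing m)]/(multiset_of (listing m) a).
by rewrite -[count_mem a (listing n)]/(multiset_of (listing n) a) !listingK.
Qed.

End Multisets.

(** * Generators and the monotone bijection from their multisets *)

Section FreeOrder.
Variables (Q : choiceType) (le : Q -> Q -> Prop) (bot : Q).
Hypothesis le_refl : forall x, le x x.
Hypothesis le_anti : forall x y, le x y -> le y x -> x = y.
Hypothesis le_bot : forall x, le bot x.
Variables (code : seq Q -> Q) (rank : Q -> nat).
Hypothesis code_inj : forall l s, bot \notin l -> bot \notin s ->
  code l = code s -> perm_eq l s.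
Hypothesis code_mono : forall l s t, perm_eq s (l ++ t) -> le (code l) (code s).
Hypothesis mem_code : forall l x, x \in l -> le x (code l).
Hypothesis rank_code : forall l x, bot \notin l -> x \in l ->
  (rank x < rank (code l))%N.
Implicit Types (x y : Q) (l s : seq Q).

(* Only meaningful for x of rank less than n.  Being a generator refers negatively to
   generators of smaller rank, hence the recursion on a bound. *)
Fixpoint generator_below n : set Q :=
  if n is n'.+1 then [set x | x <> bot /\ forall l,
    (forall y, y \in l -> generator_below n' y) -> (1 < size l)%N -> code l <> x]
  else set0.

Lemma generator_below_neq n x : generator_below n x -> x <> bot.
Proof. by case: n => [|n] // []. Qed.

Lemma generator_below_stable m n x : (rank x < m)%N -> (rank x < n)%N ->
  generator_below m x -> generator_below n x.
Proof.
have [N] := ubnP (maxn m n); elim: N m n x => // N IH [|m] [|n] x //.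
rewrite maxnSS !ltnS => mnN xm xn [x0 xP]; split=> // l ln l1 lx.
have l0 : bot \notin l by apply/negP => /ln/generator_below_neq.
apply: (xP l) => // y yl; have := rank_code l0 yl; rewrite lx => yx.
(* The condition on the members of [l] is contravariant in the bound, so the induction exchanges [m]
   and [n]. *)
apply: (IH n m) (ln y yl); first by rewrite maxnC.
  exact: leq_trans yx xn.
exact: leq_trans yx xm.
Qed.

Definition generator x := generator_below (rank x).+1 x.

Lemma generatorP x : generator x <-> x <> bot /\ forall l,
  (forall y, y \in l -> generator y) -> (1 < size l)%N -> code l <> x.
Proof.
have aux l : bot \notin l -> code l = x -> forall y, y \in l ->
    generator y <-> generator_below (rank x) y.
  move=> l0 lx y yl; have := rank_code l0 yl; rewrite lx => yx.
  by split; apply: generator_below_stable.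
split=> -[x0 xP]; split=> // l lP l1 lx.
  have l0 : bot \notin l by apply/negP => /lP/generator_below_neq.
  by apply: (xP l) => // y yl; apply/(aux l l0 lx y yl)/lP.
have l0 : bot \notin l by apply/negP => /lP/generator_below_neq.
by apply: (xP l) => // y yl; apply/(aux l l0 lx y yl)/lP.
Qed.

Definition gens l := forall y, y \in l -> generator y.

Lemma gens_bot l : gens l -> bot \notin l.
Proof. by move=> lP; apply/negP => /lP/generatorP[]. Qed.

(** A singleton goes to its element and not to its code, so that every generator is a value. *)
Definition enc l := if l is x :: s then if s is [::] then x else code l else bot.

Lemma mem_enc l x : x \in l -> le x (enc l).
Proof.
by case: l => [|y [|z l]] //; [rewrite inE => /eqP-> | exact: mem_code].
Qed.

Lemma enc_mono l s t : perm_eq s (l ++ t) -> le (enc l) (enc s).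
Proof.
case: l => [|x [|y l]] st /=; first exact: le_bot.
  by apply: mem_enc; rewrite (perm_mem st) mem_head.
by have := perm_size st; case: s st => [|a [|b s]] // /code_mono.
Qed.

(** Monotonicity in both directions and antisymmetry. *)
Lemma enc_perm l s : perm_eq l s -> enc l = enc s.
Proof.
move=> ls; apply: le_anti; apply: (@enc_mono _ _ [::]); rewrite cats0 //.
by rewrite perm_sym.
Qed.

Lemma enc_long l : (1 < size l)%N -> enc l = code l.
Proof. by case: l => [|x [|y l]]. Qed.

Lemma enc_eq_bot l : gens l -> enc l = bot -> l = [::].
Proof.
case: l => // x l lP lbot; have [] := (generatorP x).1 (lP x (mem_head _ _)).
by case; apply: le_anti => //; rewrite -lbot; apply: mem_enc; exact: mem_head.
Qed.

(** Lists of length at least two are separated by [code_inj]. A generator is never the code of such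
    a list of generators, and only the empty list yields [bot]. *)
Lemma enc_inj l s : gens l -> gens s -> enc l = enc s -> perm_eq l s.
Proof.
wlog lt : l s / (size l <= size s)%N.
  move=> h lP sP ls; have [/h|/ltnW/h] := leqP (size l) (size s); first exact.
  by rewrite perm_sym; apply.
move=> lP sP ls; have [l1|l1] := ltnP 1 (size l).
  have s1 := leq_trans l1 lt.
  by apply: code_inj; rewrite -?enc_long //; exact: gens_bot.
case: l l1 lt lP ls => [|x [|//]] _ lt lP ls.
  by rewrite (enc_eq_bot sP (esym ls)).
have [_ xP] := (generatorP x).1 (lP x (mem_head _ _)).
case: s lt sP ls => [|y [|z s]] // _ sP /= ls; first by rewrite ls.
by case: (xP _ sP).
Qed.

(** By [generatorP], an element that is neither [bot] nor a generator is the code of a list of at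
    least two generators. *)
Lemma enc_surj x : exists2 l, gens l & enc l = x.
Proof.
have [xg|xg] := pselect (generator x).
  by exists [:: x] => // y; rewrite inE => /eqP->.
have [->|x0] := pselect (x = bot); first by exists [::].
apply: contrapT => no; apply: xg; apply/generatorP; split=> // l lP l1 lx.
by apply: no; exists l => //; rewrite enc_long.
Qed.

Lemma monotone_enumeration : exists (A : Type) (f : direct_sum A nat -> Q),
  bijective f /\ forall m n, le (f m) (f (m + n)).
Proof.
pose A : choiceType := set_type generator.
pose f (m : direct_sum A nat) := enc (map val (listing m)).
have fgens (l : seq A) : gens (map val l).
  by move=> _ /mapP[a _ ->]; exact: set_mem (valP a).
have finj : injective f.
  move=> m n /enc_inj-/(_ (fgens _) (fgens _))/(perm_map_inj val_inj).
  by move/multiset_of_eq; rewrite !listingK.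
have /choice[g gP] : forall x, exists m, f m = x.
  move=> x; have [l lP <-] := enc_surj x.
  have [k ->] : exists k : seq A, l = map val k.
    elim: l lP => [|y l IH] lP; first by exists [::].
    have [|k ->] := IH; first by move=> z zl; apply: lP; rewrite inE zl orbT.
    by exists (SigSub (mem_set (lP y (mem_head _ _))) :: k).
  exists (multiset_of k); apply: enc_perm; apply: perm_map; exact: perm_listing.
exists A, f; split; first by exists g => [m|//]; apply: finj; rewrite gP.
move=> m n; apply: (@enc_mono _ _ (map val (listing n))).
by rewrite -map_cat; apply: perm_map; exact: perm_listingD.
Qed.

End FreeOrder.

Lemma surj_inj_bijective (S T : Type) (f : S -> T) :
  injective f -> (forall y, exists x, f x = y) -> bijective f.
Proof.
by move=> finj /choice[g gP]; exists g => // x; apply: finj; rewrite gP.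
Qed.

(** * The Grothendieck group of a free commutative monoid *)

Section GrothendieckFree.
Variables (A : Type) (M : nmodType) (f : {additive M -> direct_sum A nat}).
Hypothesis bij_f : bijective f.
Variable canM : cancellative M.

Lemma dsumDE (N : nmodType) (u v : direct_sum A N) a : (u + v) a = u a + v a.
Proof. by []. Qed.

Fact int_finite_support (u : direct_sum A nat) :
  (fun a => (u a)%:Z) \in @Defs.finite_support A int.
Proof.
apply/asboolP; have /asboolP := dsum_funP u.
by apply: sub_finite_set => a /=.
Qed.

Definition to_int m : direct_sum A int := DirectSum (int_finite_support (f m)).

Lemma to_intD m n : to_int (m + n) = to_int m + to_int n.
Proof.
by apply/val_inj/funext => a; rewrite /= raddfD dsumDE PoszD.
Qed.

Lemma to_int_inj : injective to_int.
Proof.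
move=> m n mn; apply: (bij_inj bij_f); apply/val_inj/funext => a.
by have [] := congr1 (fun u : direct_sum A int => u a) mn.
Qed.

(** The extension of [to_int] to formal differences, computed on a chosen representative;
    [groth_to_int_pi] shows that the choice does not matter. *)
Definition groth_to_int (x : grothendieck canM) : direct_sum A int :=
  to_int (repr x).1 - to_int (repr x).2.

Lemma groth_to_int_pi p :
  groth_to_int (\pi_(grothendieck canM)%qT p) = to_int p.1 - to_int p.2.
Proof.
have := congr1 to_int (groth_repr canM p); rewrite !to_intD /groth_to_int => e.
by apply/eqP; rewrite subr_eq addrAC e addrAC subrr add0r.
Qed.

Lemma groth_to_intD x y :
  groth_to_int (x + y) = groth_to_int x + groth_to_int y.
Proof.
elim/quotW: x => p; elim/quotW: y => q.
rewrite -[_ + _]/(groth_add _ _) -pi_groth_add !groth_to_int_pi !to_intD.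
by rewrite opprD addrACA.
Qed.

Lemma groth_to_int_inj : injective groth_to_int.
Proof.
elim/quotW=> p; elim/quotW=> q; rewrite !groth_to_int_pi => e.
apply/eqmodP; rewrite /= /groth_rel; apply/eqP/to_int_inj.
move/eqP: e; rewrite !to_intD subr_eq => /eqP->.
by rewrite addrAC subrK addrC.
Qed.

Fact part_finite_support (h : int -> nat) (d : direct_sum A int) : h 0 = 0%N ->
  h \o d \in @Defs.finite_support A nat.
Proof.
move=> h0; apply/asboolP; have /asboolP := dsum_funP d.
by apply: sub_finite_set => a /=; apply: contraNN => /eqP->; rewrite h0.
Qed.

(** Positive and negative parts, from which a preimage of [d] is built. [Negz n] stands for -(n+1),
    hence the successor in [negn]. *)
Definition posn (z : int) : nat := if z is Posz n then n else 0.
Definition negn (z : int) : nat := if z is Negz n then n.+1 else 0.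

Lemma groth_to_int_surj d : exists x, groth_to_int x = d.
Proof.
have [g gf fg] := bij_f.
pose part h h0 := g (DirectSum (@part_finite_support h d h0)).
exists (\pi_(grothendieck canM)%qT (part posn erefl, part negn erefl)).
rewrite groth_to_int_pi; apply/val_inj/funext => a.
rewrite /= -[LHS]/((f (part posn erefl) a)%:Z - (f (part negn erefl) a)%:Z).
rewrite !fg /=.
by case: (d a) => n /=; rewrite ?subr0 // sub0r NegzE.
Qed.

Lemma free_grothendieck : free_abelian_group (grothendieck canM).
Proof.
exists A.
have h0 : groth_to_int 0 = 0.
  by apply: (addrI (groth_to_int 0)); rewrite -groth_to_intD !addr0.
pose h : {additive grothendieck canM -> direct_sum A int} :=
  HB.pack groth_to_int
    (GRing.isNmodMorphism.Build _ _ groth_to_int (conj h0 groth_to_intD)).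
exists h; exact: surj_inj_bijective groth_to_int_inj groth_to_int_surj.
Qed.

End GrothendieckFree.

(** * Transport of the addition of multisets to [Fin V] *)

Theorem theoremB (K : fieldType) (V : lmodType K) :
  ~ finite_dimensional [set: V] ->
  exists (op : Fin V -> Fin V -> Fin V) (e : Fin V)
    (opA : associative op) (opC : commutative op) (op0 : left_id e op),
    let FinV : nmodType := monoid_of opA opC op0 in
    [/\ free_commutative_monoid FinV,
        forall F G : Fin V,
          val F `<=` val (op F G) /\ val G `<=` val (op F G)
      & exists canV : cancellative FinV, free_abelian_group (grothendieck canV)].
Proof.
move=> /exists_shifts[sh [pr [prsh pr0]]].
(* The order is inclusion, its least element is [zeroF], and the rank is [level]. *)
have [A [f [[g fK gK] fmono]]] := monotone_enumeration
  (le := fun F G : Fin V => val F `<=` val G)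
  (fun F => @subset_refl _ (val F))
  (fun F G FG GF => val_inj ((seteqP _ _).2 (conj FG GF)))
  (@sub0F _ V) (@code_inj _ _ sh pr prsh pr0) (@code_mono _ _ sh pr pr0)
  (@mem_code _ _ sh pr pr0) (@level_code _ _ sh pr prsh pr0).
(* With this operation [g] is an isomorphism onto the direct sum, and the required inclusions are
   the monotonicity of [f]. *)
pose op F G := f (g F + g G).
have opA : associative op by move=> F G H; rewrite /op !fK addrA.
have opC : commutative op by move=> F G; rewrite /op addrC.
have op0 : left_id (f 0) op by move=> F; rewrite /op fK add0r gK.
exists op, (f 0), opA, opC, op0 => FinV.
have gD : GRing.nmod_morphism (g : FinV -> direct_sum A nat).
  by split=> [|F G]; rewrite fK.
pose gA : {additive FinV -> direct_sum A nat} :=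
  HB.pack g (GRing.isNmodMorphism.Build FinV (direct_sum A nat) g gD).
have bij_g : bijective gA by exists f.
split.
- by exists A, gA.
- move=> F G; rewrite -{1}[F]gK -{2}[G]gK /op {2}[g F + _]addrC.
  by split; exact: fmono.
(* Cancellation is inherited pointwise from [nat] through the injection [gA]. *)
have canV : cancellative FinV.
  move=> F G H /(congr1 gA); rewrite !raddfD => e.
  apply: (bij_inj bij_g); apply/val_inj/funext => a.
  by have /addIn := congr1 (fun u : direct_sum A nat => u a) e.
exists canV; exact: free_grothendieck bij_g canV.
Qed.
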